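(* Let $\mathbf{a}=(a_n)_{n\ge0}$ be a sequence in $\mathbb{F}_q[T]$ which is not ultimately periodic, with $\deg a_n\ge1$ for all $n\ge0$, and which is primitive morphic, generated by a primitive morphism $\sigma$ on a finite set of cardinality $b\ge2$. Let $v$ be the width of $\sigma$ and let $A$ be an upper bound of $(|a_n|)_{n\ge0}$. Put $\xi:=[0,a_0,a_1,\ldots]$. Then $w_2(\xi)\le 128(4v^{4b-2}b^3+1)^3\,\mathrm{Dio}(\mathbf{a})\left(\frac{\log A}{\log q}\right)^4$.
   Context: $p$ prime, $q$ a power of $p$; $\mathbb{F}_q((T^{-1}))$ with $|\sum_{n\ge N}a_nT^{-n}|=q^{-N}$ ($a_N\ne0$); $H(P)$ is the maximum absolute value of the coefficients of $P\in(\mathbb{F}_q[T])[X]$; $w_2(\xi)$ is the supremum of $w$ with $0<|P(\xi)|\le H(P)^{-w}$ for infinitely many $P$ of degree $\le2$. $[a_0,a_1,\ldots]$ is a continued fraction. A morphism $\sigma:\mathcal{A}^*\to\mathcal{A}^*$ is primitive if for some $n\ge1$ every letter occurs in $\sigma^n(x)$ for every $x\in\mathcal{A}$; prolongable on $a$ if $\sigma(a)=aW$ with $\sigma^n(W)$ nonempty for all $n$; its width is $\max_{x\in\mathcal{A}}|\sigma(x)|$. $\mathbf{a}$ is primitive morphic generated by $\sigma$ if $\mathbf{a}=\lim_n\tau(\sigma^n(a))$ for such a primitive $\sigma$ prolongable on $a$ and a letter-to-letter map $\tau$. Words: $W^w=W^{\lfloor w\rfloor}W'$ with $W'$ the prefix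 of $W$ of length $\lceil (w-\lfloor w\rfloor)|W|\rceil$; $\mathbf{a}$ satisfies $( * )_\rho$ if there are finite words $U_n,V_n$ and reals $w_n\ge0$ with $U_nV_n^{w_n}$ a prefix of $\mathbf{a}$, $|U_nV_n^{w_n}|/|U_nV_n|\ge\rho$, $(|V_n^{w_n}|)_n$ strictly increasing; $\mathrm{Dio}(\mathbf{a})$ is the supremum of such $\rho$. *)

(* Defs.v *)
From HB Require Import structures.
From mathcomp Require Import all_boot all_order all_algebra.
From mathcomp Require Import zify ring lra.
From mathcomp Require Import all_classical all_reals all_analysis.

Set Implicit Arguments.
Unset Strict Implicit.
Unset Printing Implicit Defensive.

Import Order.TTheory GRing.Theory Num.Theory.
Import numFieldNormedType.Exports.

Local Open Scope classical_set_scope.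
Local Open Scope ring_scope.

(* The field F((T^-1)): [coefL f n] is the coefficient of T^(-n) in f;
   it vanishes for n close to -oo. *)
Record laurent (F : fieldType) := Laurent {
  coefL :> int -> F;
  coefL_bounded : exists N : int, forall n, n < N -> coefL n = 0 }.

HB.instance Definition _ (F : fieldType) := gen_eqMixin (laurent F).
HB.instance Definition _ (F : fieldType) := gen_choiceMixin (laurent F).

Section LaurentRing.
Variable F : fieldType.
Implicit Types (f g h : laurent F) (N M n : int).

Lemma laurentP f g : (forall n, f n = g n) -> f = g.
Proof.
case: f g => [f bf] [g bg] /= fg; have {fg} fg : f = g by apply/funext.
by case: _ / fg bg => bg; congr Laurent; exact: Prop_irrelevance.
Qed.

Lemma zeroL_bounded : exists N : int, forall n : int, n < N -> 0 = 0 :> F.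
Proof. by exists 0. Qed.
Definition zeroL := Laurent zeroL_bounded.

Lemma oneL_bounded :
  exists N : int, forall n : int, n < N -> (n == 0)%:R = 0 :> F.
Proof. by exists 0 => n; case: eqP => // ->. Qed.
Definition oneL := Laurent oneL_bounded.

Lemma oppL_bounded f : exists N : int, forall n, n < N -> - f n = 0.
Proof. by have [N hN] := coefL_bounded f; exists N => n /hN ->; rewrite oppr0. Qed.
Definition oppL f := Laurent (oppL_bounded f).

Lemma addL_bounded f g : exists N : int, forall n, n < N -> f n + g n = 0.
Proof.
have [N hN] := coefL_bounded f; have [M hM] := coefL_bounded g.
exists (Num.min N M) => n; rewrite lt_min => /andP[/hN -> /hM ->].
by rewrite addr0.
Qed.
Definition addL f g := Laurent (addL_bounded f g).

(* Cauchy product; only finitely many terms of the sum are nonzero. *)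
Definition convL f g n : F := \sum_(i \in [set: int]) f i * g (n - i).

Let below f N := forall n, n < N -> f n = 0.

Lemma convL_below f g N M n :
  below f N -> below g M -> n < N + M -> convL f g n = 0.
Proof.
move=> hf hg hn; apply: fsbig1 => i _.
have [/hf ->|hi] := ltP i N; first by rewrite mul0r.
by rewrite [g _]hg ?mulr0//; lia.
Qed.

Lemma mulL_bounded f g : exists N : int, forall n, n < N -> convL f g n = 0.
Proof.
have [N hN] := coefL_bounded f; have [M hM] := coefL_bounded g.
by exists (N + M) => n; exact: convL_below.
Qed.
Definition mulL f g := Laurent (mulL_bounded f g).

Let tr N m f : {poly F} := \poly_(i < m) f (N + i%:Z).

Lemma convLE f g N M (m k : nat) : below f N -> below g M -> (k < m)%N ->
  convL f g (N + M + k%:Z) = (tr N m f * tr M m g)`_k.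
Proof.
move=> hf hg km; rewrite coefM /convL.
pose A : set int := (fun j : nat => N + j%:Z) @` `I_k.+1.
rewrite -(@fsbig_widen _ _ _ _ A) //; last first.
  move=> i /= [_ nA]; have [/hf ->|hi] := ltP i N; first by rewrite mul0r.
  rewrite [g _]hg ?mulr0//; apply: contra_notT nA => hi2.
  by exists `|i - N|%N => /=; lia.
rewrite fsbig_image; last by move=> i j _ _ /=; lia.
rewrite -fsbig_ord; apply: eq_bigr => -[i /= ik] _; rewrite !coef_poly.
rewrite (leq_ltn_trans _ km)// (leq_ltn_trans (leq_subr _ _) km).
by congr (_ * g _); lia.
Qed.

Lemma eq_coefM (p p' q q' : {poly F}) (k : nat) :
  (forall i, (i <= k)%N -> p`_i = p'`_i) ->
  (forall i, (i <= k)%N -> q`_i = q'`_i) -> (p * q)`_k = (p' * q')`_k.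
Proof.
move=> hp hq; rewrite !coefM; apply: eq_bigr => -[i /= ik] _.
by rewrite hp// hq// leq_subr.
Qed.


Lemma mulLC : commutative mulL.
Proof.
move=> f g; apply: laurentP => n /=.
have [N hN] := coefL_bounded f; have [M hM] := coefL_bounded g.
have [hn|hn] := ltP n (N + M).
  by rewrite (convL_below hN hM)// (convL_below hM hN)// addrC.
have -> : n = N + M + (absz (n - (N + M))%R)%:Z by lia.
rewrite (convLE hN hM (ltnSn _)) mulrC.
by rewrite -(convLE hM hN (ltnSn _)) [M + N]addrC.
Qed.

Lemma coef_tr N (m : nat) f (i : nat) :
  (i < m)%N -> (tr N m f)`_i = f (N + i%:Z).
Proof. by move=> im; rewrite coef_poly im. Qed.

Lemma mulLA : associative mulL.
Proof.
move=> f g h; apply: laurentP => n /=.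
have [N hN] := coefL_bounded f; have [M hM] := coefL_bounded g.
have [L hL] := coefL_bounded h.
have hfg : below (mulL f g) (N + M) by move=> i; exact: convL_below.
have hgh : below (mulL g h) (M + L) by move=> i; exact: convL_below.
have [hn|hn] := ltP n (N + M + L).
  by rewrite (convL_below hN hgh) ?addrA// (convL_below hfg hL).
pose k := absz (n - (N + M + L))%R.
have -> : n = N + M + L + k%:Z by lia.
rewrite (convLE hfg hL (ltnSn k)) -[N + M + L]addrA (convLE hN hgh (ltnSn k)).
transitivity ((tr N k.+1 f * (tr M k.+1 g * tr L k.+1 h))`_k).
  apply: eq_coefM => // i ik; rewrite coef_tr ?ltnS//=.
  by rewrite (convLE hM hL (m := k.+1)).
rewrite mulrA; apply: eq_coefM => // i ik; rewrite coef_tr ?ltnS//=.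
by rewrite (convLE hN hM (m := k.+1)).
Qed.

Lemma mul1L : left_id oneL mulL.
Proof.
move=> f; apply: laurentP => n /=; rewrite /convL.
rewrite -(@fsbig_widen _ _ _ _ [set 0 : int]) //; last first.
  by move=> i /= [_ /eqP /negbTE ->]; rewrite mul0r.
by rewrite fsbig_set1 /= ?eqxx mul1r subr0.
Qed.

Lemma mulLDl : left_distributive mulL addL.
Proof.
move=> f g h; apply: laurentP => n /=.
have [N' hN'] := coefL_bounded f; have [M' hM'] := coefL_bounded g.
have [L hL] := coefL_bounded h; pose N := Num.min N' M'.
have hf : below f N by move=> i; rewrite lt_min => /andP[/hN'].
have hg : below g N by move=> i; rewrite lt_min => /andP[_ /hM'].
have hfg : below (addL f g) N by move=> i hi /=; rewrite hf// hg// addr0.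
have [hn|hn] := ltP n (N + L).
  rewrite (convL_below hfg hL)// (convL_below hf hL)// (convL_below hg hL)//.
  by rewrite addr0.
have -> : n = N + L + (absz (n - (N + L))%R)%:Z by lia.
rewrite !(convLE _ hL (ltnSn _))// -coefD -mulrDl; apply: eq_coefM => // i ik.
by rewrite coefD !coef_tr.
Qed.

Lemma addLA : associative addL.
Proof. by move=> f g h; apply: laurentP => n /=; rewrite addrA. Qed.
Lemma addLC : commutative addL.
Proof. by move=> f g; apply: laurentP => n /=; rewrite addrC. Qed.
Lemma add0L : left_id zeroL addL.
Proof. by move=> f; apply: laurentP => n /=; rewrite add0r. Qed.
Lemma addNL : left_inverse zeroL oppL addL.
Proof. by move=> f; apply: laurentP => n /=; rewrite addNr. Qed.
Lemma oneL_neq0 : oneL != zeroL.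
Proof.
apply/eqP => /(congr1 (fun f : laurent F => f 0)) /= /eqP.
by rewrite ?eqxx oner_eq0.
Qed.

HB.instance Definition _ :=
  GRing.isZmodule.Build (laurent F) addLA addLC add0L addNL.
HB.instance Definition _ :=
  GRing.Zmodule_isComNzRing.Build (laurent F) mulLA mulLC mul1L mulLDl oneL_neq0.

(* [is_ordL f N] : the leading term of f is a_N T^(-N), with a_N != 0. *)
Definition is_ordL f N := f N != 0 /\ forall n, n < N -> f n = 0.

Lemma ordL_exists f : f != 0 -> exists N, is_ordL f N.
Proof.
move=> f0; have [N hN] := coefL_bounded f.
have ex : exists k : nat, f (N + k%:Z) != 0.
  apply: contrapT => h; move/eqP: f0; apply; apply: laurentP => n /=.
  have [/hN //|hn] := ltP n N.
  apply/eqP/negPn/negP => fn; apply: h; exists (absz (n - N)%R).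
  by rewrite (_ : N + _ = n)//; lia.
case: (ex_minnP ex) => k hk kmin; exists (N + k%:Z); split=> // n hn.
have [/hN //|hn'] := ltP n N.
apply/eqP/negPn/negP => fn.
have := kmin (absz (n - N)%R); rewrite (_ : N + _ = n); last by lia.
by move=> /(_ fn); lia.
Qed.

(* Coefficients of the inverse of a power series with constant term c 0. *)
Fixpoint inv_seq (c : nat -> F) (m : nat) : seq F :=
  if m is m'.+1 then
    let s := inv_seq c m' in
    rcons s ((c 0%N)^-1 * ((m' == 0%N)%:R - \sum_(i < m') c (m' - i)%N * s`_i))
  else [::].

Lemma size_inv_seq c m : size (inv_seq c m) = m.
Proof. by elim: m => //= m IH; rewrite size_rcons IH. Qed.

Lemma nth_inv_seq c m i : (i < m)%N -> (inv_seq c m)`_i = (inv_seq c i.+1)`_i.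
Proof.
elim: m => // m IH; rewrite ltnS leq_eqVlt => /predU1P[-> //|im].
by rewrite [in LHS]/= nth_rcons size_inv_seq im IH.
Qed.

Lemma inv_seqP c k : c 0%N != 0 ->
  \sum_(i < k.+1) c (k - i)%N * (inv_seq c i.+1)`_i = (k == 0%N)%:R.
Proof.
move=> c0; rewrite big_ord_recr /= subnn nth_rcons size_inv_seq ltnn eqxx.
rewrite mulrA divff// mul1r addrC -[RHS]addr0 -addrA; congr (_ + _).
rewrite addrC; apply/eqP; rewrite subr_eq0; apply/eqP.
by apply: eq_bigr => i _; rewrite [in RHS]nth_inv_seq.
Qed.

Lemma laurent_inv_exists f : f != 0 -> exists g, g * f = 1.
Proof.
move=> /ordL_exists[N [fN hN]]; pose c k := f (N + k%:Z).
pose u n : F :=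
  if 0 <= n + N then (inv_seq c (absz (n + N)%R).+1)`_(absz (n + N)%R) else 0.
have ub : exists M : int, forall n, n < M -> u n = 0.
  by exists (- N) => n hn; rewrite /u ifF//; apply/negbTE; lia.
exists (Laurent ub); apply: laurentP => n.
have hu : below (Laurent ub) (- N).
  by move=> i hi /=; rewrite /u ifF//; apply/negbTE; lia.
rewrite -[LHS]/(convL _ _ _) -[RHS]/((n == 0)%:R).
have [hn|hn] := ltP n 0.
  by rewrite (convL_below hu hN) ?addNr//; case: eqP hn => // ->.
have -> : n = - N + N + (absz n)%:Z by lia.
rewrite (convLE hu hN (ltnSn _)) addNr add0r coefM.
transitivity ((absz n == 0%N)%:R : F); last by [].
rewrite -(@inv_seqP c); last by rewrite /c addr0.
apply: eq_bigr => -[i /= ik] _; rewrite mulrC !coef_tr//; last first.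
  by rewrite ltnS leq_subr.
congr (_ * _); rewrite /= /u ifT; last by lia.
by rewrite (_ : - N + i%:Z + N = i) // addrAC addNr add0r.
Qed.

Definition invL f : laurent F := xget 0 [set g | g * f = 1].

Lemma mulVL f : f != 0 -> invL f * f = 1.
Proof.
by move=> /laurent_inv_exists[g gf]; rewrite /invL; case: xgetP => [h _ //|/(_ g)].
Qed.

Lemma invL0 : invL 0 = 0.
Proof.
rewrite /invL; case: xgetP => // g _ /eqP.
by rewrite mulr0 eq_sym oner_eq0.
Qed.

HB.instance Definition _ := GRing.ComNzRing_isField.Build (laurent F) mulVL invL0.

(* F[T] inside F((T^-1)): the coefficient of T^k sits at index -k. *)
Lemma polyL_bounded (p : {poly F}) : exists N : int,
  forall n : int, n < N -> (if n <= 0 then p`_(absz n) else 0) = 0.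
Proof.
exists (- (size p)%:Z) => n hn; case: ifP => // n0.
by apply: nth_default; move: hn n0; case: n => k hn n0; move: hn => /=; lia.
Qed.
Definition polyL (p : {poly F}) : laurent F := Laurent (polyL_bounded p).

Lemma polyL_is_zmod_morphism : zmod_morphism polyL.
Proof.
move=> p q; apply: laurentP => n /=.
by case: ifP => _; rewrite ?subr0// coefB.
Qed.

Lemma polyL_is_monoid_morphism : monoid_morphism polyL.
Proof.
split=> [|p q]; apply: laurentP => n.
  rewrite /= coef1 -absz_eq0; case: ifP => // n0.
  by case: eqP => // ?; exfalso; lia.
rewrite -[RHS]/(convL _ _ _) /convL /=.
case: ifP => n0; last first.
  rewrite fsbig1// => i _; have [i0|] := leP i 0; last by rewrite mul0r.
  by rewrite [X in _ * X]ifF ?mulr0//; lia.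
pose k := absz n; pose A : set int := (fun j : nat => - j%:Z) @` `I_k.+1.
rewrite -(@fsbig_widen _ _ _ _ A) //; last first.
  move=> i /= [_ nA]; have [i0|] := leP i 0; last by rewrite mul0r.
  rewrite [X in _ * X]ifF ?mulr0//; apply: contra_notF nA => hi.
  by exists (absz i) => /=; lia.
rewrite fsbig_image; last by move=> i j _ _ /=; lia.
rewrite -fsbig_ord coefM; apply: eq_bigr => -[i /= ik] _.
rewrite !ifT; [|lia|lia].
by congr (p`_ _ * q`_ _); lia.
Qed.

HB.instance Definition _ :=
  GRing.isZmodMorphism.Build {poly F} (laurent F) polyL polyL_is_zmod_morphism.
HB.instance Definition _ :=
  GRing.isMonoidMorphism.Build {poly F} (laurent F) polyL polyL_is_monoid_morphism.

Definition ordL f : int := xget 0 [set N | is_ordL f N].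

Lemma ordLP f : f != 0 -> is_ordL f (ordL f).
Proof.
by move=> /ordL_exists[N hN]; rewrite /ordL; case: xgetP => [M _ //|/(_ N)].
Qed.

End LaurentRing.

Section AbsoluteValue.
Variables (R : realType) (F : finFieldType).
Implicit Types (x xi : laurent F) (P : {poly {poly F}}).

Definition absL x : R := if x == 0 then 0 else #|F|%:R ^ (- ordL x).

Definition height P : R := \big[Num.max/0]_(i < size P) absL (polyL P`_i).

Definition evalL P xi : laurent F := (map_poly (@polyL F) P).[xi].

Definition w2 xi : \bar R :=
  ereal_sup [set w%:E | w in [set w : R |
    infinite_set [set P : {poly {poly F}} |
      (size P <= 3)%N /\ 0 < absL (evalL P xi) <= height P `^ (- w)]]].

(* [:: b_1; ...; b_n] and b_0 give [b_0, b_1, ..., b_n]. *)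
Fixpoint cfrac (b0 : laurent F) (b : seq (laurent F)) : laurent F :=
  if b is b1 :: b' then b0 + (cfrac b1 b')^-1 else b0.

(* xi = [b_0, b_1, b_2, ...] *)
Definition is_cfrac xi (b : nat -> {poly F}) :=
  (fun n => absL (cfrac (polyL (b 0%N)) (mkseq (fun i => polyL (b i.+1)) n) - xi))
    @ \oo --> (0 : R).

End AbsoluteValue.

Section Words.
Implicit Types T : eqType.

Definition cons_seq {T} (x : T) (a : nat -> T) : nat -> T :=
  fun n => if n is m.+1 then a m else x.

Definition ultimately_periodic {T} (a : nat -> T) :=
  exists N k, (0 < k)%N /\ forall n, (N <= n)%N -> a (n + k)%N = a n.

Definition word_prefix {T} (u : seq T) (a : nat -> T) := u = mkseq a (size u).

Definition word_lim {T} (u : nat -> seq T) (a : nat -> T) :=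
  forall i, exists N, forall n, (N <= n)%N -> onth (u n) i = Some (a i).

(* The endomorphism of the free monoid determined by the images of letters. *)
Definition morph {S : Type} (sigma : S -> seq S) (u : seq S) : seq S :=
  flatten (map sigma u).

Definition primitive {S : eqType} (sigma : S -> seq S) :=
  exists2 n, (0 < n)%N & forall x y : S, y \in iter n (morph sigma) [:: x].

Definition prolongable {S : Type} (sigma : S -> seq S) (s : S) :=
  exists2 W, sigma s = s :: W & forall n, iter n (morph sigma) W <> [::].

Definition width {S : finType} (sigma : S -> seq S) : nat :=
  \max_(x : S) size (sigma x).

Definition primitive_morphic {S : finType} {T}
    (sigma : S -> seq S) (a : nat -> T) :=
  primitive sigma /\
  exists (s : S) (tau : S -> T), prolongable sigma s /\
    word_lim (fun n => map tau (iter n (morph sigma) [:: s])) a.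

End Words.

Section Diophantine.
Variables (R : realType) (T : eqType).

(* W^w for real w >= 0. *)
Definition wpow (W : seq T) (w : R) : seq T :=
  flatten (nseq (absz (Num.floor w)) W) ++
  take (absz (Num.ceil ((w - (Num.floor w)%:~R) * (size W)%:R))) W.

Definition star_condition (rho : R) (a : nat -> T) :=
  exists (U V : nat -> seq T) (w : nat -> R), forall n,
    [/\ 0 <= w n,
        word_prefix (U n ++ wpow (V n) (w n)) a,
        rho <= (size (U n ++ wpow (V n) (w n)))%:R / (size (U n ++ V n))%:R &
        (size (wpow (V n) (w n)) < size (wpow (V n.+1) (w n.+1)))%N].

Definition Dio (a : nat -> T) : \bar R :=
  ereal_sup [set rho%:E | rho in [set rho : R | star_condition rho a]].

End Diophantine.

(* Main.v *)
(* By primitivity, some power of the morphism maps its first letter s to a word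
   s X s Y, so applying further powers shows that [a] returns to its own prefix
   of length g_k = |sigma^k(s)| at a position r_k bounded by a constant times
   g_k.  The purely periodic continued fraction with period a_0 ... a_(r_k - 1)
   is therefore a good quadratic approximation of xi, and its defining form Q_k
   has explicit coefficients (continuants).  Given P of degree at most 2 and
   height q^h, pick the first k with g_k >= 2h and eliminate the square between P
   and Q_k.  If the resulting linear form is nonzero, it cannot be small at xi,
   because xi has bounded partial quotients; this bounds |P(xi)| from below.
   If it vanishes, P is proportional to Q_k, and |Q_k(xi)| is bounded below
   because Dio(a) bounds how long the periodicity with period r_k can last.
   This gives the constant 12 v^(b+1) Dio(a) (log A / log q), much smaller than
   the required one. *)

Require Import Defs.
From HB Require Import structures.
From mathcomp Require Import all_boot all_order all_algebra.
From mathcomp Require Import all_classical all_reals all_analysis.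
From mathcomp Require Import zify ring lra.
Import Order.TTheory GRing.Theory Num.Theory.
Import numFieldNormedType.Exports.
Local Open Scope classical_set_scope.
Local Open Scope ring_scope.

Set Implicit Arguments.
Unset Strict Implicit.

(** * Returns to prefixes in primitive morphic words *)

Section MorphicWords.
Variables (S : finType) (sigma : S -> seq S).
Implicit Types (x y s : S) (u v : seq S).
Local Notation sg k := (iter k (morph sigma)).

Lemma morph_cat u v : morph sigma (u ++ v) = morph sigma u ++ morph sigma v.
Proof. by rewrite /morph map_cat flatten_cat. Qed.

Lemma iter_morph_cat k u v : sg k (u ++ v) = sg k u ++ sg k v.
Proof. by elim: k => //= k ->; exact: morph_cat. Qed.

Lemma iter_morph_cons k x u : sg k (x :: u) = sg k [:: x] ++ sg k u.
Proof. by rewrite -iter_morph_cat. Qed.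

Lemma morph1 x : morph sigma [:: x] = sigma x.
Proof. by rewrite /morph /= cats0. Qed.

Lemma size_morph u : (size (morph sigma u) <= width sigma * size u)%N.
Proof.
elim: u => [|x u IHu]; first by rewrite muln0.
rewrite -cat1s morph_cat size_cat morph1 mulnS leq_add//.
exact: (leq_bigmax x).
Qed.

Lemma size_iter_morph k u : (size (sg k u) <= width sigma ^ k * size u)%N.
Proof.
elim: k => [|k IHk]; first by rewrite expn0 mul1n.
by rewrite (leq_trans (size_morph _))// expnS -mulnA leq_mul2l IHk orbT.
Qed.

Lemma iter_morph_connect n x y :
  y \in sg n [:: x] -> connect (fun x y => y \in sigma x) x y.
Proof.
elim: n y => [|n IHn] y; first by rewrite inE => /eqP ->.
rewrite iterS => /flattenP[w /mapP[z /IHn xz ->] yz].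
exact: connect_trans xz (connect1 yz).
Qed.

Lemma path_iter_morph x p :
  path (fun x y => y \in sigma x) x p -> last x p \in sg (size p) [:: x].
Proof.
elim: p x => [|y p IHp] x /=; first by rewrite inE.
move=> /andP[+ /IHp]; rewrite -iterS iterSr morph1 => /splitPr[u v] hp.
by rewrite iter_morph_cat iter_morph_cons !mem_cat hp orbT.
Qed.

(** By primitivity, the second letter [t] of [sigma s] reaches [s] in the graph with an edge from
    [x] to each letter of [sigma x]. A simple path meets at most [#|S|] letters, so fewer than
    [#|S|] iterations make [s] appear in the image of [t], while the image of the leading [s] still
    begins with [s]. *)
Lemma morph_first_return s : primitive sigma -> prolongable sigma s ->
  exists d X Y, (d <= #|S|)%N /\ sg d [:: s] = s :: X ++ s :: Y.
Proof.
move=> [n _ prim] [[|t W] sW Wn]; first by have := Wn 0%N.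
have /connectP[p0 p0p p0s] := iter_morph_connect (prim t s).
move: p0s; case: (shortenP p0p) => p tp up _ ps.
have pS : (size p < #|S|)%N.
  by rewrite -[_.+1]/(size (t :: p)) -(card_uniqP up) max_card.
have := path_iter_morph tp; rewrite -ps => /path.splitPr sp.
have [Z sZ] : exists Z, sg (size p) [:: s] = s :: Z.
  elim: (size p) => [|k [Z kZ]]; first by exists [::].
  by rewrite iterS kZ -cat1s morph_cat morph1 sW; eexists.
move: sp; case E : _ / => [u v].
exists (size p).+1, (Z ++ u), (v ++ sg (size p) W); split=> //.
rewrite iterSr morph1 sW iter_morph_cons (iter_morph_cons _ t) sZ E.
by rewrite /= -!catA.
Qed.

End MorphicWords.

(** Take for [g k] the length of sigma^k(s) and for [r k] that of sigma^k(s X). The latter word is a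
    prefix of sigma^d(sigma^k(s)) with [d] at most [#|S|], whence the upper bound on [r k]. *)
Lemma primitive_morphic_repetition (S : finType) (T : eqType)
    (sigma : S -> seq S) (a : nat -> T) :
  primitive_morphic sigma a -> exists g r : nat -> nat,
    [/\ g 0%N = 1%N, forall k, (g k < g k.+1)%N,
        forall k, (g k.+1 <= width sigma * g k)%N,
        forall k, (g k <= r k <= width sigma ^ #|S| * g k)%N &
        forall k i, (i < g k)%N -> a (r k + i)%N = a i].
Proof.
move=> [prim [s [tau [pro alim]]]].
have [d [X [Y [dS sX]]]] := morph_first_return prim pro.
case: pro => W sW W0.
pose sg k := iter k (morph sigma).
have sgS k : sg k.+1 [:: s] = sg k [:: s] ++ sg k W.
  by rewrite /sg iterSr morph1 sW iter_morph_cons.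
have width_gt0 : (0 < width sigma)%N.
  by apply: leq_trans (leq_bigmax s); rewrite sW.
have sgD k n : exists Z, sg (n + k)%N [:: s] = sg k [:: s] ++ Z.
  elim: n => [|n [Z nZ]]; first by exists [::]; rewrite cats0.
  by rewrite addSn sgS nZ -catA; eexists.
have a_nth k i : (i < size (sg k [:: s]))%N ->
    a i = tau (nth s (sg k [:: s]) i).
  move=> ik; have [N /(_ (N + k)%N (leq_addr _ _))] := alim i.
  have [Z E] := sgD k N; move/(onth_nth (tau s)); rewrite -/(sg _ _) E => <-.
  by rewrite (nth_map s) ?nth_cat ?size_cat ?ik ?ltn_addr.
exists (fun k => size (sg k [:: s])), (fun k => size (sg k (s :: X))).
split=> // [k|k|k|k i ik].
- rewrite sgS size_cat -[X in (X < _)%N]addn0 ltn_add2l.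
  by case E: (sg k W) => //; have := W0 k.
- exact: size_morph.
- rewrite /sg (iter_morph_cons _ _ s X) size_cat leq_addr/= -size_cat.
  rewrite -iter_morph_cons.
  have : (size (sg k (s :: X)) <= size (sg d (sg k [:: s])))%N.
    rewrite /sg -iterD addnC iterD sX -cat_cons iter_morph_cat size_cat.
    exact: leq_addr.
  move/leq_trans; apply; rewrite (leq_trans (size_iter_morph _ _ _))//.
  by rewrite leq_mul2r leq_pexp2l// orbT.
- have E : sg (k + d)%N [:: s] = sg k (s :: X) ++ sg k [:: s] ++ sg k Y.
    by rewrite /sg iterD sX -cat_cons iter_morph_cat (iter_morph_cons _ _ s Y).
  rewrite (a_nth (k + d)%N) ?(a_nth k i ik); last first.
    by rewrite E !size_cat ltn_add2l ltn_addr.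
  by rewrite E nth_cat ltnNge leq_addr/= addKn nth_cat ik.
Qed.

(** * Orders of Laurent series *)

Section Order.
Variable F : fieldType.
Implicit Types (f g x y : laurent F) (N M n : int) (p q : {poly F}).

(** Unlike [is_ordL], this holds for the zero series at every [N], so sums that may cancel need no
    case analysis. *)
Definition ord_ge f N := forall n, n < N -> f n = 0.

Lemma is_ordL_ge f N : is_ordL f N -> ord_ge f N.
Proof. by case. Qed.

Lemma ord_geW M N f : ord_ge f N -> M <= N -> ord_ge f M.
Proof. by move=> fN MN n nM; apply: fN; exact: lt_le_trans MN. Qed.

Lemma ord_geD f g N : ord_ge f N -> ord_ge g N -> ord_ge (f + g) N.
Proof. by move=> fN gN n nN; rewrite /= fN// gN// addr0. Qed.

Lemma ord_geN f N : ord_ge f N -> ord_ge (- f) N.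
Proof. by move=> fN n nN; rewrite /= fN// oppr0. Qed.

Lemma ord_geB f g N : ord_ge f N -> ord_ge g N -> ord_ge (f - g) N.
Proof. by move=> fN gN; apply: ord_geD => //; exact: ord_geN. Qed.

Lemma ord_geM f g N M : ord_ge f N -> ord_ge g M -> ord_ge (f * g) (N + M).
Proof. by move=> fN gM n; exact: convL_below. Qed.

Lemma is_ordL_le f N M : is_ordL f N -> ord_ge f M -> M <= N.
Proof.
move=> [fN _] fM; rewrite leNgt; apply/negP => /fM /eqP.
by rewrite (negbTE fN).
Qed.

Lemma is_ordL_neq0 f N : is_ordL f N -> f != 0.
Proof. by move=> [fN _]; apply: contra_neq fN => ->. Qed.

Lemma is_ordL_uniq f N M : is_ordL f N -> is_ordL f M -> N = M.
Proof.
move=> fN fM; apply/eqP; rewrite eq_le.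
by rewrite (is_ordL_le fM (is_ordL_ge fN)) (is_ordL_le fN (is_ordL_ge fM)).
Qed.

Lemma is_ordLM f g N M : is_ordL f N -> is_ordL g M -> is_ordL (f * g) (N + M).
Proof.
move=> [fN fN'] [gM gM']; split; last exact: ord_geM.
have -> : N + M = N + M + 0%N%:Z by rewrite addr0.
rewrite -[(f * g) _]/(convL f g _) (@convLE _ f g N M 1 0)//.
by rewrite coefM big_ord1 subnn !coef_poly/= !addr0 mulf_neq0.
Qed.

Lemma is_ordLD f g N M : is_ordL f N -> ord_ge g M -> N < M -> is_ordL (f + g) N.
Proof.
move=> [fN fN'] gM NM; split; first by rewrite /= gM// addr0.
by apply: ord_geD => //; apply: ord_geW gM (ltW NM).
Qed.

Lemma is_ordLV f N : is_ordL f N -> is_ordL f^-1 (- N).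
Proof.
move=> fN; have f0 := is_ordL_neq0 fN.
have [M fM] : exists M, is_ordL f^-1 M by apply: ordL_exists; rewrite invr_eq0.
have := is_ordLM fN fM; rewrite divff// => f1.
have o1 : is_ordL (1 : laurent F) 0.
  split; first by rewrite /= oner_neq0.
  by move=> n n0 /=; rewrite (lt_eqF n0).
by have /eqP := is_ordL_uniq f1 o1; rewrite addrC addr_eq0 => /eqP <-.
Qed.

Lemma ord_ge_divl f g N M : is_ordL g N -> ord_ge (g * f) M -> ord_ge f (M - N).
Proof.
move=> gN gfM.
have -> : f = g^-1 * (g * f) by rewrite mulKf// (is_ordL_neq0 gN).
by rewrite addrC; apply: ord_geM => //; exact/is_ordL_ge/is_ordLV.
Qed.

Lemma size_mul_leD p q (m n : nat) : (size p <= m.+1)%N -> (size q <= n.+1)%N ->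
  (size (p * q)%R <= (m + n).+1)%N.
Proof.
move=> pm qn; apply: leq_trans (size_polyMleq _ _) _.
by rewrite -subn1 leq_subLR add1n -addnS -addSn leq_add.
Qed.

Lemma ord_ge_poly p (n : nat) : (size p <= n.+1)%N -> ord_ge (polyL p) (- n%:Z).
Proof.
move=> pn m mn /=; case: ifP => // _; apply: nth_default.
by apply: leq_trans pn _; lia.
Qed.

Lemma is_ordL_poly p (n : nat) : size p = n.+1 -> is_ordL (polyL p) (- n%:Z).
Proof.
move=> pn; split; last by apply: ord_ge_poly; rewrite pn.
rewrite /= ifT; last by lia.
rewrite abszN absz_nat -[n]/(n.+1.-1) -pn -/(lead_coef p) lead_coef_eq0.
by rewrite -size_poly_eq0 pn.
Qed.

(** A nonzero polynomial has order minus its degree. This discreteness later turns smallness into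
    vanishing. *)
Lemma ord_ge1_poly p : ord_ge (polyL p) 1 -> p = 0.
Proof.
move=> p1; apply/eqP; rewrite -size_poly_eq0.
case E : (size p) => [//|n].
by have := is_ordL_le (is_ordL_poly E) p1; lia.
Qed.

End Order.

(** * Continued fractions *)

Section Continuants.
Variable F : fieldType.
Implicit Types (a : nat -> {poly F}) (x y : {poly F}).

(* [continuant a 1 0 n] and [continuant a 0 1 n] are the classical p_(n-1) and
   q_(n-1) of the continued fraction [0, a 0, a 1, ...], from index -1 on. *)
Fixpoint continuant a x y n : {poly F} :=
  if n is m.+1 then
    if m is k.+1 then a k * continuant a x y m + continuant a x y k else y
  else x.

Lemma continuantE a x y n : continuant a x y n.+2 =
  a n * continuant a x y n.+1 + continuant a x y n.
Proof. by []. Qed.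

(** For [a i] of positive degree, this is the degree of [continuant a 0 1 n.+1]. *)
Definition degsum a n := (\sum_(i < n) (size (a i)).-1)%N.

Lemma degsumS a n : degsum a n.+1 = (degsum a n + (size (a n)).-1)%N.
Proof. by rewrite /degsum big_ord_recr. Qed.

Lemma degsumD a m n :
  degsum a (m + n) = (degsum a m + degsum (fun i => a (m + i)%N) n)%N.
Proof. by rewrite /degsum big_split_ord. Qed.

Lemma eq_degsum a a' n : (forall i, (i < n)%N -> a i = a' i) ->
  degsum a n = degsum a' n.
Proof. by move=> h; apply: eq_bigr => i _; rewrite h. Qed.

Lemma degsum_le a D n : (forall i, (size (a i) <= D.+1)%N) ->
  (degsum a n <= D * n)%N.
Proof.
move=> aD; elim: n => [|n IHn]; first by rewrite /degsum big_ord0.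
by rewrite degsumS mulnS addnC leq_add//; have := aD n; lia.
Qed.

Lemma degsum_ge a n : (forall i, (2 <= size (a i))%N) -> (n <= degsum a n)%N.
Proof.
move=> a2; elim: n => [//|n IHn].
by rewrite degsumS; have := a2 n; lia.
Qed.

Lemma degsum_leS a n : (degsum a n <= degsum a n.+1)%N.
Proof. by rewrite degsumS leq_addr. Qed.

Lemma continuant_size_le a x y n : (size x <= 1)%N -> (size y <= 1)%N ->
  (size (continuant a x y n) <= (degsum a n).+1)%N /\
  (size (continuant a x y n.+1) <= (degsum a n).+1)%N.
Proof.
move=> x1 y1; elim: n => [|n [IH0 IH1]].
  by rewrite /degsum big_ord0.
have le := degsum_leS a n; split; first exact: leq_trans IH1 _.
rewrite continuantE (leq_trans (size_polyD _ _))// geq_max; apply/andP; split.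
  rewrite (leq_trans (size_polyMleq _ _))// degsumS.
  by move: IH1; case: (size (a n)) => [|k]; lia.
exact: leq_trans IH0 _.
Qed.

(** The degrees of [z] increase strictly, so the leading term of [c n * z n.+1] cannot cancel. This
    serves both the denominators and the cross differences of convergents. *)
Lemma recurrence_size (c z : nat -> {poly F}) n :
  (forall i, (2 <= size (c i))%N) -> z 0%N = 0 -> size (z 1%N) = 1%N ->
  (forall i, z i.+2 = c i * z i.+1 + z i) ->
  size (z n.+1) = (degsum c n).+1.
Proof.
move=> c2 z0 z1 zS.
suff: (size (z n) < size (z n.+1))%N /\ size (z n.+1) = (degsum c n).+1 by case.
elim: n => [|n [IH1 IH2]].
  by rewrite z0 z1 size_poly0 /degsum big_ord0.
have s : size (c n * z n.+1) = (degsum c n.+1).+1.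
  have c0 : c n != 0 by rewrite -size_poly_gt0 (leq_trans _ (c2 n)).
  rewrite size_mul//; last by rewrite -size_poly_gt0 IH2.
  by rewrite IH2 degsumS addnS/= addnC -addnS prednK// ltnW.
have lt : (size (z n) < size (c n * z n.+1)%R)%N.
  by rewrite s (leq_trans IH1)// IH2 ltnS degsum_leS.
rewrite zS size_polyDl// s; split=> //.
by rewrite IH2 ltnS degsumS -addn1 leq_add2l -ltnS prednK// ltnW.
Qed.

End Continuants.

(** * Convergents and the exact size of their errors *)

Section Convergents.
Variables (F : fieldType) (a : nat -> {poly F}).
Hypothesis a_deg : forall n, (2 <= size (a n))%N.
Local Notation num := (continuant a 1 0).
Local Notation den := (continuant a 0 1).

Lemma size_den n : size (den n.+1) = (degsum a n).+1.
Proof. by apply: recurrence_size => //; rewrite size_poly1. Qed.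

Lemma size_den_le n : (size (den n) <= (degsum a n).+1)%N.
Proof. by case: (@continuant_size_le _ a 0 1 n); rewrite ?size_poly0 ?size_poly1. Qed.

Lemma size_numS_le n : (size (num n.+1) <= (degsum a n).+1)%N.
Proof. by case: (@continuant_size_le _ a 1 0 n); rewrite ?size_poly0 ?size_poly1. Qed.

Lemma is_ordL_den n : is_ordL (polyL (den n.+1)) (- (degsum a n)%:Z).
Proof. exact/is_ordL_poly/size_den. Qed.

Lemma convergent_det n : num n * den n.+1 - num n.+1 * den n = (-1) ^+ n.
Proof.
elim: n => [|n IHn]; first by rewrite /= mul1r mul0r subr0.
by rewrite exprS -IHn !continuantE; ring.
Qed.

(** As [i] varies, the cross difference obeys the recurrence of the shifted sequence, with initial
    values 0 and, by the determinant identity, 1 or -1. *)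
Lemma size_convergent_cross n i :
  size (den n * num (n + i.+1)%N - num n * den (n + i.+1)%N) =
  (degsum (fun j => a (n + j)%N) i).+1.
Proof.
pose z i := den n * num (n + i)%N - num n * den (n + i)%N.
apply: (@recurrence_size _ (fun j => a (n + j)%N) z) => //.
- by rewrite /z addn0 mulrC subrr.
- have -> : z 1%N = - (-1) ^+ n.
    by rewrite -convergent_det /z addn1; ring.
  by rewrite size_polyN -[_ ^+ n]mulr1 size_Msign size_poly1.
- by move=> k; rewrite /z !addnS !continuantE; ring.
Qed.

Section Remainders.
Variable xi : laurent F.
Hypothesis xi_lim : forall (B : int) (M : nat), exists2 m, (M <= m)%N &
  ord_ge (polyL (num m.+1) / polyL (den m.+1) - xi) B.

Definition err n := polyL (den n) * xi - polyL (num n).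

Lemma errE n : err n.+2 = polyL (a n) * err n.+1 + err n.
Proof. by rewrite /err !continuantE !rmorphD !rmorphM; ring. Qed.

(** Replacing [xi] by a far convergent turns [err n] into a cross difference divided by [den m.+1],
    whose order is known exactly. *)
Lemma is_ordL_err n : is_ordL (err n) (degsum a n)%:Z.
Proof.
(* Multiplying by [den n] loses at most [degsum a n], so this precision keeps the replacement error
   strictly below the main term. *)
have [m nm mB] := xi_lim ((degsum a n)%:Z + (degsum a n)%:Z + 1) n.
have dm : polyL (den m.+1) != 0 := is_ordL_neq0 (is_ordL_den m).
pose z := den n * num m.+1 - num n * den m.+1.
have -> : err n = polyL z / polyL (den m.+1) -
    polyL (den n) * (polyL (num m.+1) / polyL (den m.+1) - xi).
  by rewrite /err /z rmorphB !rmorphM; field.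
have zE : size z = (degsum (fun j => a (n + j)%N) (m - n)).+1.
  by rewrite -size_convergent_cross addnS subnKC.
have := is_ordLM (is_ordL_poly zE) (is_ordLV (is_ordL_den m)).
have -> : - (degsum (fun j => a (n + j)%N) (m - n))%:Z - - (degsum a m)%:Z =
          (degsum a n)%:Z.
  by rewrite -[in degsum a m](subnKC nm) degsumD; lia.
move=> /is_ordLD; apply.
  exact: ord_geN (ord_geM (ord_ge_poly (size_den_le n)) mB).
lia.
Qed.

(* The value at [xi] of the quadratic form whose root is the purely periodic
   continued fraction with period [a 0, ..., a r.-1]. *)
Definition period_form r := xi * err r + err r.+1.

(** While the quotients agree, all terms obey the same recurrence in [l]. The induction carries two
    consecutive values, starting from [err 0 = -1] and [err 1 = xi]. *)
Lemma period_form_agree r l : (forall i, (i < l)%N -> a (r + i)%N = a i) ->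
  period_form r * polyL (den l.+1) = err (r + l.+1)%N + err r * err l.+1 /\
  period_form r * polyL (den l) = err (r + l)%N + err r * err l.
Proof.
elim: l => [|l IHl] al.
  have e1 : err 1 = xi by rewrite /err /= rmorph0 rmorph1 mul1r subr0.
  have e0 : err 0 = - 1 by rewrite /err /= rmorph0 rmorph1 mul0r sub0r.
  rewrite addn1 addn0 e1 e0 /period_form [den 1]/= [den 0]/= rmorph0 rmorph1.
  by split; ring.
have [|IH1 IH0] := IHl; first by move=> i il; exact/al/ltnW.
split=> //; rewrite !addnS !errE al// continuantE rmorphD rmorphM mulrDr IH0.
by rewrite mulrCA IH1 addnS; ring.
Qed.

Lemma period_form_ge r l : (forall i, (i < l)%N -> a (r + i)%N = a i) ->
  ord_ge (period_form r) (degsum a r + 2 * degsum a l + 1)%:Z.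
Proof.
move=> al; have [E _] := period_form_agree al.
have {al}al : degsum a (r + l) = (degsum a r + degsum a l)%N.
  by rewrite degsumD; congr (_ + _)%N; apply: eq_degsum => i /al.
have -> : (degsum a r + 2 * degsum a l + 1)%:Z =
    (degsum a r + degsum a l + 1)%:Z - (- (degsum a l)%:Z) by lia.
apply: ord_ge_divl (is_ordL_den l) _; rewrite mulrC E.
have dl := degsumS a l; have al2 := a_deg l.
apply: ord_geD; first apply: ord_geW (is_ordL_ge (is_ordL_err _)) _.
  by rewrite (addnS r l) degsumS al; have := a_deg (r + l)%N; lia.
apply: ord_geW (is_ordL_ge (is_ordLM (is_ordL_err _) (is_ordL_err _))) _.
lia.
Qed.

(** At the first mismatch the two recurrences use different quotients. The defect
    [polyL d * err (r + l).+1] has an exactly known order, and a smaller [period_form r] would force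
    a larger one. *)
Lemma period_form_lt r l : (forall i, (i < l)%N -> a (r + i)%N = a i) ->
  a (r + l)%N != a l ->
  ~ ord_ge (period_form r) (degsum a (r + l).+1 + degsum a l.+1 + 1)%:Z.
Proof.
move=> al nal Qge; have [E1 E0] := period_form_agree al.
have {al}al : degsum a (r + l) = (degsum a r + degsum a l)%N.
  by rewrite degsumD; congr (_ + _)%N; apply: eq_degsum => i /al.
pose d := a l - a (r + l)%N.
have d0 : d != 0 by rewrite subr_eq0 eq_sym.
have dS : size d = (size d).-1.+1 by rewrite prednK// size_poly_gt0.
have E : polyL d * err (r + l).+1 =
    period_form r * polyL (den l.+2) - err (r + l).+2 - err r * err l.+2.
  rewrite !errE continuantE /d rmorphB rmorphD rmorphM.
  rewrite [period_form r * _]mulrDr E0 [period_form r * _]mulrCA E1.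
  by rewrite addnS; ring.
(* The ultrametric inequality for [a l - d]; it makes [err r * err l.+2] negligible against the
   defect. *)
have dd : ((size (a (r + l)%N)).-1 <= (size d).-1 + (size (a l)).-1)%N.
  have [h|h] := leqP (size (a (r + l)%N)) (size (a l)).
    by have := a_deg l; lia.
  by rewrite /d addrC size_polyDl ?size_polyN// leq_addr.
have dl := degsumS a l; have dl1 := degsumS a l.+1; have := a_deg l.
have drl := degsumS a (r + l); have drl1 := degsumS a (r + l).+1.
have := a_deg (r + l)%N.+1; have := a_deg l.+1; have := a_deg (r + l)%N => h1 h2 h3 h4.
have L := is_ordLM (is_ordL_poly dS) (is_ordL_err (r + l).+1).
have : ord_ge (polyL d * err (r + l).+1)
    (- (size d).-1%:Z + (degsum a (r + l).+1)%:Z + 1).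
  rewrite E; apply: ord_geB; first apply: ord_geB.
  - apply: ord_geW (ord_geM Qge (is_ordL_ge (is_ordL_den _))) _; lia.
  - apply: ord_geW (is_ordL_ge (is_ordL_err _)) _; lia.
  - apply: ord_geW (is_ordL_ge (is_ordLM (is_ordL_err _) (is_ordL_err _))) _.
    lia.
by move/(is_ordL_le L); lia.
Qed.

Variable D : nat.
Hypothesis a_le : forall n, (size (a n) <= D.+1)%N.

(* Bounded partial quotients make [xi] badly approximable: otherwise two
   consecutive convergents would solve the same homogeneous equation. *)
Lemma linear_form_lt (u v : {poly F}) h : (size u <= h.+1)%N ->
  (u != 0) || (v != 0) ->
  ~ ord_ge (polyL u * xi + polyL v) (h + D + 1)%:Z.
Proof.
move=> uh uv xge.
(* The two consecutive convergents are those whose denominator degrees enclose [h]. *)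
have [n nh hn] : exists2 n, (degsum a n <= h)%N & (h < degsum a n.+1)%N.
  have ex : exists n, (h < degsum a n)%N.
    by exists h.+1; exact: degsum_ge.
  case: (ex_minnP ex) => -[|n] hn hmin; first by rewrite /degsum big_ord0 in hn.
  by exists n => //; rewrite leqNgt; apply/negP => /hmin; rewrite ltnn.
have dn := degsumS a n; have an := a_le n.
(* The [D] in the bound absorbs the growth from [degsum a n] to [degsum a n.+1], so the product with
   the larger denominator still has order at least 1. *)
have zero k : (n <= k <= n.+1)%N -> u * num k.+1 + v * den k.+1 = 0.
  move=> kn; apply: ord_ge1_poly.
  have -> : polyL (u * num k.+1 + v * den k.+1) =
      polyL (den k.+1) * (polyL u * xi + polyL v) - polyL u * err k.+1.
    by rewrite /err rmorphD !rmorphM; ring.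
  have [kn1 kn2] : (degsum a k <= degsum a n.+1 /\
                   degsum a n.+1 <= degsum a k.+1)%N.
    case/andP: kn; rewrite leq_eqVlt => /predU1P[<- _|nk kn].
      by have := degsum_leS a n.
    have -> : k = n.+1 by apply/eqP; rewrite eqn_leq kn.
    by have := degsum_leS a n.+1.
  apply: ord_geB.
    apply: ord_geW (ord_geM (is_ordL_ge (is_ordL_den k)) xge) _; lia.
  apply: ord_geW (ord_geM (ord_ge_poly uh) (is_ordL_ge (is_ordL_err _))) _.
  lia.
have Z0 := zero n; have Z1 := zero n.+1.
have {}Z0 : u * num n.+1 + v * den n.+1 = 0 by apply: Z0; lia.
have {}Z1 : u * num n.+2 + v * den n.+2 = 0 by apply: Z1; lia.
have det := convergent_det n.+1.
have sgn0 : (-1) ^+ n.+1 != 0 :> {poly F} by rewrite signr_eq0.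
have u0 : u = 0.
  apply: (mulIf sgn0); rewrite -det mul0r.
  transitivity ((u * num n.+1 + v * den n.+1) * den n.+2 -
    (u * num n.+2 + v * den n.+2) * den n.+1); first by ring.
  by rewrite Z0 Z1 !mul0r subr0.
have v0 : v = 0.
  apply: (mulIf sgn0); rewrite -det mul0r.
  transitivity (- ((u * num n.+1 + v * den n.+1) * num n.+2) +
    (u * num n.+2 + v * den n.+2) * num n.+1); first by ring.
  by rewrite Z0 Z1 !mul0r oppr0 addr0.
by move: uv; rewrite u0 v0 eqxx.
Qed.

(* Eliminating the square between the given form and [period_form r]
   leaves a linear form, to which [linear_form_lt] applies unless it is zero,
   that is unless the two quadratic forms are proportional. *)
Lemma quadratic_form_le (c0 c1 c2 : {poly F}) (h m r : nat) (e : int) :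
  (size c0 <= h.+1)%N -> (size c1 <= h.+1)%N -> (size c2 <= h.+1)%N ->
  (0 < r)%N -> (h + D <= m)%N ->
  (forall i, (i < m)%N -> a (r + i)%N = a i) -> a (r + m)%N != a m ->
  is_ordL (polyL c2 * xi ^+ 2 + polyL c1 * xi + polyL c0) e ->
  e <= (2 * D * r + h + D)%:Z \/ e <= (D * (2 * r + 2 * m + 2))%:Z.
Proof.
move=> s0 s1 s2 r0 hm am nam.
set x := (X in is_ordL X e) => xe.
case: r r0 am nam => // r _ am nam.
have Qge := period_form_ge am; have Qlt := period_form_lt am nam.
set q := period_form r.+1 in Qge Qlt.
have qE : q = polyL (den r.+1) * xi ^+ 2 +
    polyL (den r.+2 - num r.+1) * xi - polyL (num r.+2).
  by rewrite /q /period_form /err rmorphB; ring.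
(* The coefficients left after cancelling [xi ^+ 2] between [den r.+1 * x] and [c2 * q]. *)
pose u := den r.+1 * c1 - c2 * (den r.+2 - num r.+1).
pose v := den r.+1 * c0 + c2 * num r.+2.
have uvE : polyL u * xi + polyL v = polyL (den r.+1) * x - polyL c2 * q.
  by rewrite qE /x /u /v rmorphB rmorphD !rmorphM /=; ring.
have rS := degsum_leS a r.
have denxe := is_ordLM (is_ordL_den r) xe.
have dle k : (degsum a k <= D * k)%N by exact: degsum_le.
have [/andP[/eqP u0 /eqP v0]|uv] := boolP ((u == 0) && (v == 0)).
  (* Proportional forms: [c2 * q] equals [den r.+1 * x], so a larger [e] would give [q] an order
     excluded by [period_form_lt]. *)
  right; rewrite leNgt; apply/negP => elt; apply: Qlt.
  move/eqP: uvE; rewrite u0 v0 rmorph0 mul0r addr0 eq_sym subr_eq0 => /eqP E.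
  rewrite E in denxe.
  have c20 : c2 != 0.
    by apply: contra_neq (is_ordL_neq0 denxe) => ->; rewrite rmorph0 mul0r.
  have c2S : size c2 = (size c2).-1.+1 by rewrite prednK// size_poly_gt0.
  apply: ord_geW (ord_ge_divl (is_ordL_poly c2S) (is_ordL_ge denxe)) _.
  have := dle r; have := dle (r.+1 + m).+1; have := dle m.+1; lia.
left; rewrite leNgt; apply/negP => elt.
have size_uv (p1 p2 p3 p4 : {poly F}) : (size p1 <= (degsum a r.+1).+1)%N ->
    (size p2 <= h.+1)%N -> (size p3 <= h.+1)%N ->
    (size p4 <= (degsum a r.+1).+1)%N ->
    (size (p1 * p2 - p3 * p4)%R <= (h + degsum a r.+1).+1)%N.
  move=> h1 h2 h3 h4; rewrite (leq_trans (size_polyD _ _))// size_polyN geq_max.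
  apply/andP; split; last exact: size_mul_leD.
  by rewrite addnC; exact: size_mul_leD.
have su : (size u <= (h + degsum a r.+1).+1)%N.
  apply: size_uv => //; first by rewrite size_den.
  rewrite (leq_trans (size_polyD _ _))// size_polyN geq_max size_den leqnn.
  exact: leq_trans (size_numS_le r) _.
apply: (linear_form_lt su (v := v)); first by rewrite -negb_and.
(* Agreement over [m >= h + D] places makes [c2 * q] too small for [linear_form_lt], despite the
   degree of [u]. *)
have m_le := degsum_ge m a_deg.
rewrite uvE; apply: ord_geB.
  apply: ord_geW (is_ordL_ge denxe) _.
  have := dle r; have := dle r.+1; lia.
apply: ord_geW (ord_geM (ord_ge_poly s2) Qge) _; lia.
Qed.

End Remainders.
End Convergents.

(** * Finite continued fractions as quotients of continuants *)

Section ContinuedFraction.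
Variables (F : finFieldType) (a : nat -> {poly F}).
Hypothesis a_deg : forall n, (2 <= size (a n))%N.
Local Notation num := (continuant a 1 0).
Local Notation den := (continuant a 0 1).

Lemma is_ordL_cfrac r n :
  is_ordL (cfrac (polyL (a r)) [seq polyL (a i) | i <- iota r.+1 n])
    (- (size (a r)).-1%:Z).
Proof.
have ar k : size (a k) = (size (a k)).-1.+1 by rewrite prednK// ltnW.
elim: n r => [|n IHn] r /=; first exact: is_ordL_poly.
apply: is_ordLD (is_ordL_poly (ar r)) (is_ordL_ge (is_ordLV (IHn r.+1))) _.
by have := a_deg r; have := a_deg r.+1; lia.
Qed.

(** The full fraction is a Moebius transform of its tail [z], written cross-multiplied to avoid
    denominators. The induction moves [a r] from the tail into the continuants. *)
Lemma cfrac_moebius r n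
    (z := cfrac (polyL (a r)) [seq polyL (a i) | i <- iota r.+1 n]) :
  polyL (num (r + n).+2) * (polyL (den r.+1) * z + polyL (den r)) =
  polyL (den (r + n).+2) * (polyL (num r.+1) * z + polyL (num r)).
Proof.
rewrite {}/z; elim: n r => [|n IHn] r.
  by rewrite addn0 !continuantE !rmorphD !rmorphM /=; ring.
rewrite -addSnnS; have := IHn r.+1.
move: (polyL (num (_ + _).+2)) (polyL (den (_ + _).+2)) => U V.
rewrite !(continuantE _ _ _ r) [map _ _]/=.
have := is_ordL_neq0 (is_ordL_cfrac r.+1 n).
rewrite [cfrac (polyL (a r)) _]/=; move: (cfrac _ _) => z z0.
rewrite !rmorphD !rmorphM => E; apply: (mulfI z0).
have h A B C : z * (A * (B + z^-1) + C) = (B * A + C) * z + A by field.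
by rewrite mulrCA h [RHS]mulrCA h.
Qed.

Lemma cfrac_convergent n :
  cfrac (polyL 0) (mkseq (fun i => polyL (a i)) n.+1) =
  polyL (num n.+2) / polyL (den n.+2).
Proof.
have := cfrac_moebius 0 n; have := is_ordL_neq0 (is_ordL_den a_deg n.+1).
have := is_ordL_neq0 (is_ordL_cfrac 0 n).
rewrite add0n /mkseq [cfrac (polyL 0) _]/=; move: (cfrac _ _) => z z0.
move: (polyL (num n.+2)) (polyL (den n.+2)) => U V V0.
rewrite [den 1]/= [den 0]/= [num 1]/= [num 0]/= rmorph0 rmorph1.
rewrite mul1r addr0 mul0r !add0r mulr1 => E.
by apply: (mulIf z0); rewrite mulVf// mulrAC E divff.
Qed.

End ContinuedFraction.

(** * The Diophantine exponent *)

Section PowersOfPrefixes.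
Variables (R : realType) (T : eqType).
Implicit Types (a : nat -> T) (V : seq T).

(** With this exponent the fractional part times [size V] is the integer [k %% size V], so the
    ceiling rounds nothing. *)
Lemma wpow_ratio V k : (0 < size V)%N ->
  wpow V (k%:R / (size V)%:R : R) =
  flatten (nseq (k %/ size V) V) ++ take (k %% size V) V.
Proof.
move=> V0; have V0R : 0 < (size V)%:R :> R by rewrite ltr0n.
have kE : k%:R = (k %/ size V)%:R * (size V)%:R + (k %% size V)%:R :> R.
  by rewrite -natrM -natrD -divn_eq.
have wE : k%:R / (size V)%:R =
    (k %/ size V)%:R + (k %% size V)%:R / (size V)%:R :> R.
  by rewrite [in LHS]kE mulrDl mulfK// gt_eqF.
have fl : Num.floor (k%:R / (size V)%:R : R) = (k %/ size V)%:Z.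
  apply: floor_def; rewrite wE -pmulrn lerDl divr_ge0//=.
  by rewrite rmorphD/= ltrD2l ltr_pdivrMr// mul1r ltr_nat ltn_pmod.
rewrite /wpow fl absz_nat wE -pmulrn addrC addKr mulfVK ?gt_eqF//.
by rewrite pmulrn intrKceil absz_nat.
Qed.

Lemma periodic_mkseq a r q t : (t <= r)%N ->
  (forall i, (i + r < q * r + t)%N -> a (r + i)%N = a i) ->
  flatten (nseq q (mkseq a r)) ++ take t (mkseq a r) = mkseq a (q * r + t).
Proof.
move=> tr; elim: q => [|q IHq] per.
  by rewrite -map_take take_iota (minn_idPl tr).
rewrite [nseq _ _]/= [flatten _]/= -catA IHq; last first.
  by move=> i iq; apply: per; rewrite mulSn; lia.
rewrite mulSn -addnA /mkseq (iotaD 0 r) map_cat add0n; congr (_ ++ _).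
have -> k : iota r k = map (addn r) (iota 0 k) by rewrite -iotaDl addn0.
rewrite -map_comp; apply/eq_in_map => i.
by rewrite mem_iota add0n => /andP[_ iq] /=; rewrite per// mulSn; lia.
Qed.

Lemma star_condition_of_returns a (rho : R) :
  (forall N, exists r m, [/\ (N <= r)%N, (0 < r)%N,
     forall i, (i < m)%N -> a (r + i)%N = a i &
     rho * r%:R <= (r + m)%:R]) ->
  star_condition rho a.
Proof.
move=> h; have {h} /choice[f fP] : forall N, exists p : nat * nat,
    [/\ (N <= p.1)%N, (0 < p.1)%N,
     forall i, (i < p.2)%N -> a (p.1 + i)%N = a i &
     rho * p.1%:R <= (p.1 + p.2)%:R].
  by move=> N; have [r [m rm]] := h N; exists (r, m).
(* Each new period exceeds the whole length of the previous power, which makes the lengths strictly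
   increasing. *)
pose s n := iter n (fun p => f (p.1 + p.2).+1) (f 0%N).
have sP n : [/\ (0 < (s n).1)%N,
    forall i, (i < (s n).2)%N -> a ((s n).1 + i)%N = a i &
    rho * (s n).1%:R <= ((s n).1 + (s n).2)%:R].
  by case: n => [|n] /=; [have [] := fP 0%N | have [] := fP ((s n).1 + (s n).2).+1].
pose w n : R := ((s n).1 + (s n).2)%:R / (s n).1%:R.
have wE n : wpow (mkseq a (s n).1) (w n) = mkseq a ((s n).1 + (s n).2).
  have [s0 sa _] := sP n.
  have := @wpow_ratio (mkseq a (s n).1) ((s n).1 + (s n).2).
  rewrite size_mkseq => /(_ s0) ->; rewrite periodic_mkseq -?divn_eq//.
    exact/ltnW/ltn_pmod.
  by move=> i; rewrite addnC ltn_add2l; exact: sa.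
exists (fun=> [::]), (fun n => mkseq a (s n).1), w => n.
have [s0 _ rs] := sP n; split.
- by rewrite divr_ge0.
- by rewrite /word_prefix wE /= size_mkseq.
- by rewrite wE /= !size_mkseq ler_pdivlMr// ltr0n.
- rewrite !wE !size_mkseq; have [+ _ _ _] := fP ((s n).1 + (s n).2).+1.
  by move=> h; apply: leq_trans h _; exact: leq_addr.
Qed.

Lemma Dio_ge1 a : (1 <= Dio R a)%E.
Proof.
apply: ereal_sup_ubound; exists 1 => //; apply: star_condition_of_returns => N.
by exists N.+1, 0%N; split=> //; rewrite mul1r addn0.
Qed.

(** Otherwise arbitrarily long periods [r] would have powers of length at least [(d + 1) * r], and
    [d + 1] would be admissible. *)
Lemma returns_bounded a (d : R) : Dio R a = d%:E ->
  exists N, forall r m, (N <= r)%N -> (forall i, (i < m)%N -> a (r + i)%N = a i) ->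
    m%:R < d * r%:R.
Proof.
move=> ad; apply: contrapT => nex.
suff : star_condition (d + 1) a.
  move=> st; have : ((d + 1)%:E <= Dio R a)%E.
    by apply: ereal_sup_ubound; exists (d + 1).
  by rewrite ad lee_fin -[leRHS]addr0 lerD2l ler10.
apply: star_condition_of_returns => N; apply: contrapT => nN; apply: nex.
exists N.+1 => r m Nr am; rewrite ltNge; apply/negP => md; apply: nN.
exists r, m; split=> //; [exact: ltnW|exact: leq_ltn_trans Nr|].
by rewrite mulrDl mul1r natrD addrC lerD2l.
Qed.

End PowersOfPrefixes.

(** * Quadratic approximation *)

Section AbsoluteValues.
Variables (R : realType) (F : finFieldType).
Implicit Types (x xi : laurent F) (P : {poly {poly F}}) (a : nat -> {poly F}).
Let q : R := #|F|%:R.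

Lemma card_field_gt1 : 1 < q.
Proof. by rewrite ltr1n card_finRing_gt1. Qed.

Lemma card_field_gt0 : 0 < q.
Proof. exact: lt_trans card_field_gt1. Qed.

Lemma absLE x N : is_ordL x N -> absL R x = q ^ (- N).
Proof.
move=> xN; have x0 := is_ordL_neq0 xN.
by rewrite /absL (negbTE x0) (is_ordL_uniq (ordLP x0) xN).
Qed.

Lemma absL_poly (p : {poly F}) n : size p = n.+1 -> absL R (polyL p) = q ^+ n.
Proof. by move=> /is_ordL_poly/absLE ->; rewrite opprK. Qed.

Lemma absL_lt_ord_ge x B : absL R x < q ^ (- B) -> ord_ge x B.
Proof.
have [-> _ //|x0] := eqVneq x 0.
have xo := ordLP x0; rewrite (absLE xo) ltr_eXz2l ?card_field_gt1// ltrN2 => Bx.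
exact: ord_geW (is_ordL_ge xo) (ltW Bx).
Qed.

Lemma is_cfrac_convergents a xi : (forall n, (2 <= size (a n))%N) ->
  is_cfrac R xi (cons_seq 0 a) ->
  forall (B : int) (M : nat), exists2 m, (M <= m)%N &
    ord_ge (polyL (continuant a 1 0 m.+1) / polyL (continuant a 0 1 m.+1) - xi) B.
Proof.
move=> a2 /cvgr0_norm_lt h B M.
have /h[N _ NP] : 0 < q ^ (- B) by rewrite exprz_gt0// card_field_gt0.
exists (maxn M N).+1; first by rewrite leqW// leq_maxl.
have := NP (maxn M N).+1; rewrite /= leqW ?leq_maxr// => /(_ isT) /=.
rewrite -(cfrac_convergent a2) => lt; apply: absL_lt_ord_ge.
exact: le_lt_trans (ler_norm _) lt.
Qed.

Lemma evalL_quadratic P xi : (size P <= 3)%N ->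
  evalL P xi = polyL P`_2 * xi ^+ 2 + polyL P`_1 * xi + polyL P`_0.
Proof.
move=> P3; rewrite /evalL (@horner_coef_wide _ 3); last first.
  exact: leq_trans (size_poly _ _) P3.
rewrite !big_ord_recr big_ord0 /= !coef_map_id0 ?rmorph0//.
by ring.
Qed.

Lemma height_ge P i h : size P`_i = h.+1 -> q ^+ h <= height R P.
Proof.
move=> Pi; have iP : (i < size P)%N.
  by rewrite ltnNge; apply/negP => /leq_sizeP/(_ i (leqnn i)) E;
    rewrite E size_poly0 in Pi.
rewrite -(absL_poly Pi) /height.
exact: (le_bigmax 0 (fun i : 'I_(size P) => absL R (polyL P`_i)) (Ordinal iP)).
Qed.

(** Infinitely many [P] of bounded degree must therefore have coefficients of unbounded degree. *)
Lemma finite_bounded_poly n m :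
  finite_set [set P : {poly {poly F}} |
    (size P <= n)%N /\ forall i, (size (P`_i)%R <= m)%N].
Proof.
pose f (t : {ffun 'I_n * 'I_m -> F}) : {poly {poly F}} :=
  \poly_(i < n) \poly_(j < m)
    (if insub i is Some i' then if insub j is Some j' then t (i', j') else 0 else 0).
apply: (@sub_finite_set _ _ (f @` setT)); last exact/finite_image/finite_finset.
move=> P [Pn Pm]; exists [ffun ij : 'I_n * 'I_m => P`_(ij.1)`_(ij.2)] => //.
apply/polyP => i; rewrite coef_poly; case: ltnP => ni; last first.
  by rewrite nth_default// (leq_trans Pn).
apply/polyP => j; rewrite coef_poly; case: ltnP => mj; last first.
  by rewrite nth_default// (leq_trans (Pm i)).
by rewrite !insubT// ffunE.
Qed.

End AbsoluteValues.

(** * The bound for [w2] when the Diophantine exponent is finite *)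

Section MorphicContinuedFraction.
Variables (R : realType) (F : finFieldType) (S : finType) (sigma : S -> seq S).
Variables (a : nat -> {poly F}) (xi : laurent F) (D : nat) (d : R).
Hypothesis a_deg : forall n, (2 <= size (a n))%N.
Hypothesis a_le : forall n, (size (a n) <= D.+1)%N.
Hypothesis a_morphic : primitive_morphic sigma a.
Hypothesis xi_cfrac : is_cfrac R xi (cons_seq 0 a).
Hypothesis a_Dio : Dio R a = d%:E.

Lemma quadratic_ord_le : exists h0, forall (P : {poly {poly F}}) h e,
  (size P <= 3)%N -> (h0 <= h)%N -> (forall i, (size (P`_i)%R <= h.+1)%N) ->
  is_ordL (evalL P xi) e ->
  e%:~R <= 12 * D%:R * (width sigma ^ #|S|.+1)%:R * d * h%:R :> R.
Proof.
have [g [r [g0 gS gw rg ar]]] := primitive_morphic_repetition a_morphic.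
have [N Nret] := returns_bounded a_Dio.
have D_gt0 : (0 < D)%N by rewrite -ltnS (leq_trans (a_deg 0%N)).
have g_ge k : (k <= g k)%N.
  by elim: k => // k IHk; exact: leq_ltn_trans IHk (gS k).
have d_ge1 : 1 <= d by have := Dio_ge1 R a; rewrite a_Dio lee_fin.
(* [N <= h] puts the period within reach of [returns_bounded]; [D <= h] gives [h + D <= 2 * h]. *)
exists (maxn N D) => P h e P3; rewrite geq_max => /andP[Nh Dh] Ph Pe.
have h_gt0 : (0 < h)%N := leq_trans D_gt0 Dh.
have ex : exists k, (2 * h <= g k)%N by exists (2 * h)%N.
(* Minimality gives [g k < 2 * h], hence control of [g k.+1] and of the period; index 0 is excluded
   by [g 0 = 1]. *)
case: (ex_minnP ex) => -[|k] kg kmin; first by rewrite g0 in kg; lia.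
have gk : (g k < 2 * h)%N.
  by rewrite ltnNge; apply/negP => /kmin; rewrite ltnn.
have /andP[r_ge r_le] := rg k.+1.
set n := r k.+1 in r_ge r_le.
set Y := (width sigma ^ #|S|.+1 * h)%N.
have nY : (n <= 2 * Y)%N.
  apply: leq_trans r_le _; rewrite /Y expnSr mulnCA -!mulnA.
  apply: leq_mul => //; apply: leq_trans (gw k) _.
  by rewrite leq_mul2l (ltnW gk) orbT.
have Nn : (N <= n)%N by apply: leq_trans r_ge; apply: leq_trans kg; lia.
(* Endless agreement would include more than [d * n] places, against [returns_bounded]. *)
have [m [am nam]] : exists m, (forall i, (i < m)%N -> a (n + i)%N = a i) /\
    a (n + m)%N != a m.
  have exm : exists m, a (n + m)%N != a m.
    apply: contrapT => nex.
    have /(Nret n (Num.truncn (d * n%:R)).+1 Nn) :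
        forall i, (i < (Num.truncn (d * n%:R)).+1)%N -> a (n + i)%N = a i.
      by move=> i _; apply/eqP/negPn/negP => ni; apply: nex; exists i.
    by rewrite ltNge ltW// truncnS_gt.
  case: (ex_minnP exm) => m nm mmin; exists m; split=> // i im.
  by apply/eqP/negPn/negP => /mmin; rewrite leqNgt im.
have md := Nret n m Nn am.
have gm : (g k.+1 <= m)%N.
  by rewrite leqNgt; apply/negP => /(ar k.+1)/eqP; apply/negP.
have n_gt0 : (0 < n)%N by apply: leq_trans r_ge; apply: leq_trans kg; lia.
rewrite evalL_quadratic// in Pe.
have hm : (h + D <= m)%N by apply: leq_trans gm; apply: leq_trans kg; lia.
have hY : (h <= Y)%N.
  rewrite /Y -[X in (X <= _)%N]mul1n leq_mul2r expn_gt0.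
  have := gw 0%N; have := gS 0%N; rewrite g0 muln1 => h1 h2.
  by rewrite (leq_trans _ h2)// ?orbT// ltnW.
have W0 : 12 * D%:R * (width sigma ^ #|S|.+1)%:R * d * h%:R =
    12 * (D%:R * Y%:R * d) :> R by rewrite /Y natrM; ring.
rewrite W0.
have D1 : 1 <= D%:R :> R by rewrite ler1n.
have hYR : h%:R <= Y%:R :> R by rewrite ler_nat.
have nYR : n%:R <= 2 * Y%:R :> R by rewrite -natrM ler_nat.
have DhR : D%:R <= h%:R :> R by rewrite ler_nat.
have n1 : 1 <= n%:R :> R by rewrite ler1n.
have Y1 : 1 <= Y%:R :> R by rewrite ler1n (leq_trans h_gt0).
have DY : Y%:R <= D%:R * Y%:R :> R by rewrite ler_peMl//; lra.
have DYd : D%:R * Y%:R <= D%:R * Y%:R * d :> R by rewrite ler_peMr//; nra.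
have [le|le] := quadratic_form_le a_deg (is_cfrac_convergents a_deg xi_cfrac)
  a_le (Ph 0%N) (Ph 1%N) (Ph 2%N) n_gt0 hm am nam Pe.
- have : e%:~R <= (2 * D * n + h + D)%:R :> R by rewrite (pmulrn 1) ler_int.
  rewrite !natrD !natrM => le2.
  have : D%:R * n%:R <= D%:R * (2 * Y%:R) :> R by rewrite ler_wpM2l.
  lra.
- have : e%:~R <= (D * (2 * n + 2 * m + 2))%:R :> R.
    by rewrite (pmulrn 1) ler_int.
  rewrite natrM !natrD !natrM => le2.
  have nd : n%:R <= d * n%:R :> R by rewrite ler_peMl//; lra.
  (* Each of [n], [m] and 1 is at most [d * n], which gives the factor 6; [n <= 2 * Y] then doubles
     it to 12. *)
  have : D%:R * (2 * n%:R + 2 * m%:R + 2) <= D%:R * (6 * (d * n%:R)) :> R.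
    by rewrite ler_wpM2l//; lra.
  have : D%:R * (d * n%:R) <= D%:R * (d * (2 * Y%:R)) :> R.
    by rewrite ler_wpM2l// ler_wpM2l//; lra.
  lra.
Qed.

Lemma w2_le : (w2 R xi <= (12 * D%:R * (width sigma ^ #|S|.+1)%:R * d)%:E)%E.
Proof.
set W := _ * d; have [h0 h0P] := quadratic_ord_le.
have d_ge1 : 1 <= d by have := Dio_ge1 R a; rewrite a_Dio lee_fin.
have W_ge0 : 0 <= W by rewrite !mulr_ge0//; lra.
apply: ge_ereal_sup => _ [w /= winf <-]; rewrite lee_fin leNgt; apply/negP => Ww.
(* Outside this finite set some coefficient has degree [h > h0]. Then the height is at least q^h and
   [e <= W * h], so taking logarithms forces [w <= W]. *)
apply: winf; apply: sub_finite_set (@finite_bounded_poly F 3 h0.+1).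
move=> P [P3 /andP[x_gt0 xH]]; split=> // j; rewrite leqNgt; apply/negP => Pj.
have [i iP] : exists i : 'I_3, forall j, (size (P`_j)%R <= size (P`_i)%R)%N.
  have [i _ imax] := @arg_maxnP _ ord0 xpredT (fun i : 'I_3 => size P`_i) isT.
  exists i => j'; have [j3|j3] := ltnP j' 3.
    exact: (imax (Ordinal j3)).
  by rewrite nth_default ?size_poly0// (leq_trans P3).
have iS : size P`_i = (size P`_i).-1.+1.
  by rewrite prednK// (leq_trans _ (iP j))// (leq_trans _ Pj).
set h := (size P`_i).-1 in iS.
have hh0 : (h0 < h)%N by rewrite -ltnS -iS (leq_trans Pj).
have x0 : evalL P xi != 0.
  by apply: contraTneq x_gt0 => ->; rewrite /absL eqxx ltxx.
have xo := ordLP x0; set e := ordL _ in xo.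
have le := h0P P h e P3 (ltnW hh0) _ xo.
have {le}le : e%:~R <= W * h%:R by apply: le => j'; rewrite -iS.
have lnq : 0 < ln #|F|%:R :> R by rewrite ln_gt0// card_field_gt1.
have q0 := card_field_gt0 R F.
have H0 : 0 < height R P.
  by apply: lt_le_trans (height_ge R iS); rewrite exprn_gt0.
have lnH : h%:R * ln #|F|%:R <= ln (height R P).
  rewrite mulr_natl -lnXn// ler_ln ?posrE// ?exprn_gt0//.
  exact: (height_ge R iS).
have : ln (absL R (evalL P xi)) <= - w * ln (height R P).
  by rewrite -ln_powR ler_ln ?posrE// powR_gt0.
rewrite (absLE R xo) -powR_intmul ?(ltW q0)// ln_powR mulrNz mulNr mulNr lerN2 => wH.
have h1 : 0 < h%:R :> R by rewrite ltr0n (leq_ltn_trans _ hh0).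
have : w * (h%:R * ln #|F|%:R) <= (W * h%:R) * ln #|F|%:R.
  apply: le_trans (_ : w * ln (height R P) <= _).
    by rewrite ler_wpM2l// ltW// (le_lt_trans W_ge0).
  by apply: le_trans wH _; rewrite ler_wpM2r// ltW.
by rewrite mulrA ler_pM2r// ler_pM2r// leNgt Ww.
Qed.

End MorphicContinuedFraction.

Unset Implicit Arguments.
Set Strict Implicit.

Theorem theorem2p10 (R : realType) (F : finFieldType) (a : nat -> {poly F})
    (S : finType) (sigma : S -> seq S) (b v : nat) (A : R) (xi : laurent F)
    (a_not_periodic : ~ ultimately_periodic a)
    (a_deg : forall n, (2 <= size (a n))%N)
    (S_card : #|S| = b) (b_ge2 : (2 <= b)%N)
    (a_morphic : primitive_morphic sigma a)
    (v_width : width sigma = v)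
    (a_bound : forall n, absL R (polyL (a n)) <= A)
    (xi_cfrac : is_cfrac R xi (cons_seq 0 a)) :
  (w2 R xi <=
    (128%:R * (4%:R * v%:R ^+ (4 * b - 2) * b%:R ^+ 3 + 1) ^+ 3)%:E
    * Dio R a * ((ln A / ln #|F|%:R) ^+ 4)%:E)%E.
Proof.
set L := ln A / ln #|F|%:R.
have q1 : 1 < #|F|%:R :> R := card_field_gt1 R F.
have lnq : 0 < ln #|F|%:R :> R by rewrite ln_gt0.
have deg_le n : (size (a n)).-1%:R <= L.
  have an : size (a n) = (size (a n)).-1.+1 by rewrite prednK// ltnW.
  have := a_bound n; rewrite (absL_poly R an) => qA.
  have q0 : 0 < #|F|%:R ^+ (size (a n)).-1 :> R.
    by rewrite exprn_gt0// (lt_trans _ q1).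
  rewrite ler_pdivlMr// mulr_natl -lnXn ?(lt_trans _ q1)// ler_ln ?posrE//.
  exact: lt_le_trans qA.
have L_ge1 : 1 <= L.
  by apply: le_trans (deg_le 0%N); rewrite ler1n -ltnS prednK// ltnW.
(* Degrees are integers bounded by [L], hence by its integer part. *)
pose D := Num.truncn L.
have a_le n : (size (a n) <= D.+1)%N.
  rewrite -[size (a n)](@prednK _ (ltnW (a_deg n))) ltnS.
  by rewrite truncn_ge_nat// (le_trans _ L_ge1).
have DL : D%:R <= L ^+ 4.
  apply: (@le_trans _ _ L); first by rewrite -truncn_ge_nat// (le_trans _ L_ge1).
  by rewrite ler_eXnr.
have v1 : 1 <= v%:R :> R.
  rewrite ler1n -v_width; case: a_morphic => _ [s [_ [[W sW _] _]]].
  by apply: leq_trans (leq_bigmax s); rewrite sW.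
set C := 128%:R * _.
(* Since [b >= 2], [b + 1 <= 4 * b - 2]; the cube only increases [X >= 1], and 12 is below 128. *)
have CE : 12 * v%:R ^+ b.+1 <= C.
  have vE : v%:R ^+ b.+1 <= v%:R ^+ (4 * b - 2) :> R by rewrite ler_weXn2l//; lia.
  have v0 : 1 <= v%:R ^+ (4 * b - 2) :> R by rewrite exprn_ege1.
  have b1 : 1 <= b%:R ^+ 3 :> R by rewrite exprn_ege1// ler1n ltnW.
  pose X : R := 4%:R * v%:R ^+ (4 * b - 2) * b%:R ^+ 3 + 1.
  have XE : v%:R ^+ (4 * b - 2) <= X by rewrite /X; nra.
  have X3 : X <= X ^+ 3 by rewrite ler_eXnr// (le_trans v0).
  by rewrite /C -/X; lra.
have C_gt0 : 0 < C by apply: lt_le_trans CE; rewrite mulr_gt0// exprn_gt0//; lra.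
have L4 : 0 < L ^+ 4 by rewrite exprn_gt0//; lra.
have Dio1 := Dio_ge1 R a.
(* If the exponent is infinite, positivity of the other factors makes the right-hand side
   infinite. *)
case aD : (Dio R a) => [d| |]; last by rewrite aD in Dio1.
- have d1 : 1 <= d by rewrite -lee_fin -aD.
  apply: le_trans (w2_le a_deg a_le a_morphic xi_cfrac aD) _.
  rewrite -!EFinM lee_fin v_width S_card natrX.
  have -> : 12 * D%:R * v%:R ^+ b.+1 * d = (12 * v%:R ^+ b.+1) * d * D%:R by ring.
  apply: ler_pM => //; last by rewrite ler_wpM2r//; lra.
  by rewrite !mulr_ge0// ?exprn_ge0//; lra.
- by rewrite gt0_muley ?lte_fin// gt0_mulye ?lte_fin// leey.
Qed.
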